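(* For any $\alpha\in\mathbb{N}_0$, $\lambda,\eta,\delta\in\mathbb{C}$ and $n\in\mathbb{N}$, the following relation holds: $${}_{\mathfrak{B}}\mathcal{F}_n^{(\alpha)}(x_1,x_2;\lambda;\eta,\delta)=\sum_{k=0}^{n}\binom{n}{k}\,\mathcal{F}_k^{(\alpha)}(0;\lambda;\eta,\delta)\,\mathfrak{B}_{n-k}(x_1;x_2).$$
   Context: $\mathbb{N}$ is the set of natural numbers, $\mathbb{N}_0$ the set of non-negative integers, $\mathbb{C}$ the set of complex numbers; $x_1,x_2$ are variables. For $\alpha\in\mathbb{N}_0$ and $\lambda,\eta,\delta\in\mathbb{C}$, the Bell based Apostol type polynomials ${}_{\mathfrak{B}}\mathcal{F}_n^{(\alpha)}(x_1,x_2;\lambda;\eta,\delta)$ of order $\alpha$ are defined by the generating function $$\sum_{n\ge 0}{}_{\mathfrak{B}}\mathcal{F}_n^{(\alpha)}(x_1,x_2;\lambda;\eta,\delta)\frac{t^n}{n!}=\left(\frac{2^{\eta}t^{\delta}}{\lambda e^{t}+1}\right)^{\alpha}e^{x_1t+x_2(e^t-1)},\qquad |t|<|\log(-\lambda)|.$$ The generalized Apostol type polynomials $\mathcal{F}_n^{(\alpha)}(x_1;\lambda;\eta,\delta)$ of order $\alpha$ ($\alpha\in\mathbb{N}_0$, $\lambda,\eta,\delta\in\mathbb{C}$) are defined by $$\sum_{n\ge 0}\mathcal{F}_n^{(\alpha)}(x_1;\lambda;\eta,\delta)\frac{t^n}{n!}=\left(\frac{2^{\eta}t^{\delta}}{\lambda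 e^{t}+1}\right)^{\alpha}e^{x_1t},\qquad |t|<|\log(-\lambda)|,$$ and their values $\mathcal{F}_n^{(\alpha)}(0;\lambda;\eta,\delta)$ at $x_1=0$ are the Apostol type numbers of order $\alpha$. The bivariate Bell polynomials $\mathfrak{B}_n(x_1;x_2)$ are defined by $\sum_{n\ge 0}\mathfrak{B}_n(x_1;x_2)\frac{t^n}{n!}=e^{x_1t}e^{x_2(e^t-1)}$. *)

(* Defs.v *)
From Stdlib Require Import Reals Factorial ClassicalEpsilon.
From Coquelicot Require Import Coquelicot.
Open Scope C_scope.

Definition Cexp (z : C) : C :=
  (exp (Re z) * cos (Im z), exp (Re z) * sin (Im z))%R.

(* Principal argument, with values in (-PI, PI]; only meaningful for z <> 0. *)
Definition Carg (z : C) : R :=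
  if Rle_dec 0 (Im z) then acos (Re z / Cmod z) else (- acos (Re z / Cmod z))%R.

Definition Clog (z : C) : C := (ln (Cmod z), Carg z).

(* Principal branch of z^w; only meaningful for z <> 0. *)
Definition Cpower (z w : C) : C := Cexp (w * Clog z).

(* [a] is the sequence in  sum_n a_n t^n/n! = f(t)  on the domain D.  The point
   t = 0 is left out: there t^delta need not make sense, and for lambda = -1 the
   generating function has a removable singularity (0/0) at t = 0, as with the
   classical t/(e^t-1).  The values at t <> 0 already determine the sequence. *)
Definition is_egf (D : C -> Prop) (f : C -> C) (a : nat -> C) : Prop :=
  forall t : C, D t -> t <> 0 ->
    is_series (K := C_AbsRing) (V := C_NormedModule)
      (fun n : nat => a n * (t ^ n / RtoC (INR (fact n)))) (f t).

(* The sequence generated by f on D; it is the zero sequence, by convention, when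
   f has no such expansion (e.g. alpha = 1, delta = 1/2 below). *)
Definition egf_coef (D : C -> Prop) (f : C -> C) : nat -> C :=
  match excluded_middle_informative (exists a, is_egf D f a) with
  | left h => proj1_sig (constructive_indefinite_description _ h)
  | right _ => fun _ => 0
  end.

(* The disc |t| < |log(-lambda)|, with the usual conventions in the two cases that
   the formula does not cover literally: |log 0| is +oo, and for lambda = -1 the
   nonzero logarithms of 1 of least modulus, +-2 i PI, give the radius 2 PI (as
   for the Bernoulli numbers). *)
Definition apostol_disc (lambda t : C) : Prop :=
  if Ceq_dec lambda 0 then True
  else if Ceq_dec lambda (-1) then (Cmod t < 2 * PI)%R
  else (Cmod t < Cmod (Clog (- lambda)))%R.

Definition apostol_factor (alpha : nat) (lambda eta delta t : C) : C :=
  (Cpower 2 eta * Cpower t delta / (lambda * Cexp t + 1)) ^ alpha.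

Definition bell_apostol (alpha : nat) (x1 x2 lambda eta delta : C) : nat -> C :=
  egf_coef (apostol_disc lambda)
    (fun t => apostol_factor alpha lambda eta delta t
              * Cexp (x1 * t + x2 * (Cexp t - 1))).

Definition apostol (alpha : nat) (x1 lambda eta delta : C) : nat -> C :=
  egf_coef (apostol_disc lambda)
    (fun t => apostol_factor alpha lambda eta delta t * Cexp (x1 * t)).

Definition bell (x1 x2 : C) : nat -> C :=
  egf_coef (fun _ => True)
    (fun t => Cexp (x1 * t) * Cexp (x2 * (Cexp t - 1))).

(* Main.v *)
Require Import Defs.
From Stdlib Require Import Reals.
From Coquelicot Require Import Coquelicot.
From Stdlib Require Import Factorial Lra Lia ClassicalEpsilon.
Open Scope C_scope.

(** The generating function of the Bell based numbers is the product of that of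
    the Apostol type numbers and of the entire function
    [Cexp (x1 * t + x2 * (Cexp t - 1))], which generates the bivariate Bell
    polynomials.  Multiplying two convergent exponential generating functions
    convolves their coefficients binomially ([is_egf_mult], a Cauchy product of
    absolutely convergent series), and the coefficients are determined by the
    function near 0 ([is_egf_unique]); the identity follows by comparing
    coefficients.

    The Apostol factor need not have an expansion, and its coefficients are then
    0 by convention.  In that case the Bell based function has no expansion
    either: multiplying it by [Cexp (- x1 * t - x2 * (Cexp t - 1))], which has
    one, would give an expansion of the Apostol factor.  Both sides are then 0.
    Nothing about the Apostol factor is used beyond its being a function on the
    disc.

    That the Bell function is the sum of a power series on the whole plane is
    Dobinski's formula ([is_egf_dobinski]): expanding the outer exponential,
      [e^(x1 t) e^(x2 (e^t - 1)) = e^(-x2) sum_k x2^k/k! e^((x1 + k) t)],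
    and then each inner one, one exchanges the two summations
    ([is_Cseries_swap]). *)

(** * Complex series *)

(** Convergence of the complex series [sum_n a n] to [l]. *)
Definition is_Cseries (a : nat -> C) (l : C) : Prop :=
  is_series (K := C_AbsRing) (V := C_NormedModule) a l.

Lemma Re_sum_n (a : nat -> C) (n : nat) :
  Re (sum_n a n) = sum_n (fun k => Re (a k)) n.
Proof.
  induction n as [|n IH].
  - now rewrite !sum_O.
  - rewrite !sum_Sn, <- IH. reflexivity.
Qed.

Lemma Im_sum_n (a : nat -> C) (n : nat) :
  Im (sum_n a n) = sum_n (fun k => Im (a k)) n.
Proof.
  induction n as [|n IH].
  - now rewrite !sum_O.
  - rewrite !sum_Sn, <- IH. reflexivity.
Qed.

Lemma im_le_Cmod (z : C) : (Rabs (Im z) <= Cmod z)%R.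
Proof. eapply Rle_trans; [apply Rmax_r | apply (Rmax_Cmod z)]. Qed.

Lemma is_Cseries_iff (a : nat -> C) (l : C) :
  is_Cseries a l <->
  is_series (fun n => Re (a n)) (Re l) /\ is_series (fun n => Im (a n)) (Im l).
Proof.
  unfold is_Cseries, is_series. split.
  - intros H; split; intros P [e He].
    + destruct (H (fun z => P (Re z))) as [N HN].
      { exists e. intros y [Hy _]. now apply He. }
      exists N. intros n Hn. rewrite <- Re_sum_n. now apply HN.
    + destruct (H (fun z => P (Im z))) as [N HN].
      { exists e. intros y [_ Hy]. now apply He. }
      exists N. intros n Hn. rewrite <- Im_sum_n. now apply HN.
  - intros [H1 H2] P [e He].
    destruct (H1 (ball (Re l) e)) as [N1 HN1]; [now exists e|].
    destruct (H2 (ball (Im l) e)) as [N2 HN2]; [now exists e|].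
    exists (max N1 N2). intros n Hn. apply He. split.
    + generalize (HN1 n ltac:(lia)). now rewrite <- Re_sum_n.
    + generalize (HN2 n ltac:(lia)). now rewrite <- Im_sum_n.
Qed.

Lemma is_Cseries_ext (a b : nat -> C) (l : C) :
  (forall n, a n = b n) -> is_Cseries a l -> is_Cseries b l.
Proof. apply is_series_ext. Qed.

Lemma is_Cseries_unique (a : nat -> C) (l l' : C) :
  is_Cseries a l -> is_Cseries a l' -> l = l'.
Proof.
  rewrite !is_Cseries_iff. intros [H1 H2] [H3 H4].
  apply injective_projections.
  - apply is_series_unique in H1, H3. unfold Re in *. congruence.
  - apply is_series_unique in H2, H4. unfold Im in *. congruence.
Qed.

Lemma is_Cseries_minus (a b : nat -> C) (la lb : C) :
  is_Cseries a la -> is_Cseries b lb ->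
  is_Cseries (fun n => a n - b n) (la - lb).
Proof. exact (is_series_minus (K := C_AbsRing) (V := C_NormedModule) a b la lb). Qed.

Lemma is_Cseries_scal (c : C) (a : nat -> C) (l : C) :
  is_Cseries a l -> is_Cseries (fun n => c * a n) (c * l).
Proof. exact (is_series_scal (K := C_AbsRing) (V := C_NormedModule) c a l). Qed.

Lemma is_Cseries_sum_n (a : nat -> nat -> C) (c : nat -> C) (N : nat) :
  (forall n, is_Cseries (fun k => a k n) (c n)) ->
  is_Cseries (fun k => sum_n (a k) N) (sum_n c N).
Proof.
  intros H. induction N as [|N IH].
  - rewrite sum_O. apply is_Cseries_ext with (2 := H 0%nat).
    intros k. now rewrite sum_O.
  - rewrite sum_Sn.
    apply is_Cseries_ext with (fun k => sum_n (a k) N + a k (S N)).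
    + intros k. now rewrite sum_Sn.
    + exact (is_series_plus (K := C_AbsRing) (V := C_NormedModule)
               _ _ _ _ IH (H (S N))).
Qed.

(** The sum of a complex series, taken on real and imaginary parts; it is
    meaningful only for convergent series. *)
Definition CSeries (a : nat -> C) : C :=
  (Series (fun n => Re (a n)), Series (fun n => Im (a n))).

Lemma is_Cseries_dominated (a : nat -> C) (b : nat -> R) :
  (forall n, (Cmod (a n) <= b n)%R) -> ex_series b ->
  is_Cseries a (CSeries a).
Proof.
  intros H Hb. apply is_Cseries_iff; split; apply Series_correct;
    apply (ex_series_le (K := R_AbsRing) (V := R_CompleteNormedModule))
      with (2 := Hb); intros n; eapply Rle_trans; try apply H.
  - apply re_le_Cmod.
  - apply im_le_Cmod.
Qed.

Lemma Cmod_sum_n (a : nat -> C) (n : nat) :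
  (Cmod (sum_n a n) <= sum_n (fun k => Cmod (a k)) n)%R.
Proof.
  induction n as [|n IH].
  - rewrite !sum_O. apply Rle_refl.
  - rewrite !sum_Sn. eapply Rle_trans; [apply Cmod_triangle|].
    apply Rplus_le_compat_r, IH.
Qed.

Lemma Cmod_Cseries_le (a : nat -> C) (b : nat -> R) (l : C) (m : R) :
  (forall n, (Cmod (a n) <= b n)%R) -> is_Cseries a l -> is_series b m ->
  (Cmod l <= m)%R.
Proof.
  intros H Ha Hb.
  refine (is_lim_seq_le (fun n => Cmod (sum_n a n)) (sum_n b) (Cmod l) m
            _ _ Hb).
  - intros n. eapply Rle_trans; [apply Cmod_sum_n|].
    now apply sum_n_m_le.
  - apply (filterlim_comp _ _ _ _ _ _ _ _ Ha).
    exact (filterlim_norm (K := C_AbsRing) (V := C_NormedModule) l).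
Qed.

(** Cauchy product, obtained from the four real products of real and imaginary
    parts. *)
Lemma is_Cseries_mult (a b : nat -> C) (la lb : C) :
  is_Cseries a la -> is_Cseries b lb ->
  ex_series (fun n => Cmod (a n)) -> ex_series (fun n => Cmod (b n)) ->
  is_Cseries (fun n => sum_n (fun k => a k * b (n - k)%nat) n) (la * lb).
Proof.
  rewrite !is_Cseries_iff. intros [Ra Ia] [Rb Ib] Ha Hb.
  assert (Hre : forall c, ex_series (fun n => Cmod (c n)) ->
            ex_series (fun n => Rabs (Re (c n)))).
  { intros c. apply (ex_series_le (K := R_AbsRing) (V := R_CompleteNormedModule)).
    intros n. unfold norm; simpl. rewrite Rabs_Rabsolu. apply re_le_Cmod. }
  assert (Him : forall c, ex_series (fun n => Cmod (c n)) ->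
            ex_series (fun n => Rabs (Im (c n)))).
  { intros c. apply (ex_series_le (K := R_AbsRing) (V := R_CompleteNormedModule)).
    intros n. unfold norm; simpl. rewrite Rabs_Rabsolu. apply im_le_Cmod. }
  pose proof (is_series_mult _ _ _ _ Ra Rb (Hre _ Ha) (Hre _ Hb)) as RR.
  pose proof (is_series_mult _ _ _ _ Ia Ib (Him _ Ha) (Him _ Hb)) as II.
  pose proof (is_series_mult _ _ _ _ Ra Ib (Hre _ Ha) (Him _ Hb)) as RI.
  pose proof (is_series_mult _ _ _ _ Ia Rb (Him _ Ha) (Hre _ Hb)) as IR.
  split.
  - eapply is_series_ext; [|exact (is_series_minus _ _ _ _ RR II)].
    intros n. rewrite Re_sum_n, <- !sum_n_Reals.
    change (sum_n (fun k => Re (a k) * Re (b (n - k)%nat))%R n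
            - sum_n (fun k => Im (a k) * Im (b (n - k)%nat))%R n
            = sum_n (fun k => Re (a k * b (n - k)%nat)) n)%R.
    rewrite !sum_n_Reals, <- minus_sum. now apply sum_eq.
  - eapply is_series_ext; [|exact (is_series_plus _ _ _ _ RI IR)].
    intros n. rewrite Im_sum_n, <- !sum_n_Reals.
    change (sum_n (fun k => Re (a k) * Im (b (n - k)%nat))%R n
            + sum_n (fun k => Im (a k) * Re (b (n - k)%nat))%R n
            = sum_n (fun k => Im (a k * b (n - k)%nat)) n)%R.
    rewrite !sum_n_Reals, <- plus_sum. now apply sum_eq.
Qed.

Lemma is_lim_seq_squeeze (u e : nat -> R) (l : R) :
  (forall n, (Rabs (l - u n) <= e n)%R) -> is_lim_seq e 0 -> is_lim_seq u l.
Proof.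
  intros H He.
  apply (is_lim_seq_le_le (fun n => l - e n)%R _ (fun n => l + e n)%R).
  - intros n. generalize (H n). intros Hn. apply Rabs_le_between in Hn. lra.
  - replace (Finite l) with (Finite (l - 0)%R) by (f_equal; ring).
    apply is_lim_seq_minus'; [apply is_lim_seq_const | exact He].
  - replace (Finite l) with (Finite (l + 0)%R) by (f_equal; ring).
    apply is_lim_seq_plus'; [apply is_lim_seq_const | exact He].
Qed.

(** Exchange of summations in a double series.  The geometric decay in [n],
    uniform in [k] up to the summable factor [M k], bounds by a multiple of
    [(/ 2) ^ N] what the first [N + 1] columns leave out of the total. *)
Lemma is_Cseries_swap (a : nat -> nat -> C) (M : nat -> R) (r c : nat -> C)
    (l : C) :
  (forall k n, (Cmod (a k n) <= M k * (/ 2) ^ n)%R) -> ex_series M ->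
  (forall k, is_Cseries (a k) (r k)) ->
  (forall n, is_Cseries (fun k => a k n) (c n)) ->
  is_Cseries r l -> is_Cseries c l.
Proof.
  intros Hb [m HM] Hr Hc Hl.
  assert (Hgeom : is_series (fun n => (/ 2) ^ n)%R 2).
  { assert (E : (/ (1 - / 2) = 2)%R) by field.
    assert (H : (Rabs (/ 2) < 1)%R) by (rewrite Rabs_pos_eq; lra).
    apply is_series_geom in H. now rewrite E in H. }
  (* Tail of row [k]: the terms beyond [N] add up to at most
     [M k * (/ 2) ^ N]. *)
  assert (Htail : forall k N,
            (Cmod (r k - sum_n (a k) N) <= (/ 2) ^ N * M k)%R).
  { intros k N.
    refine (Cmod_Cseries_le (fun n => a k (S N + n)%nat)
              (fun n => M k * (/ 2) ^ S N * (/ 2) ^ n)%R _ _ _ _ _).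
    - intros n. rewrite Rmult_assoc, <- pow_add. apply Hb.
    - apply (is_series_incr_n (K := C_AbsRing) (V := C_NormedModule) (a k));
        [lia|].
      change (is_Cseries (a k) (r k - sum_n (a k) N + sum_n (a k) N)).
      replace (r k - sum_n (a k) N + sum_n (a k) N) with (r k); [apply Hr|].
      ring.
    - replace ((/ 2) ^ N * M k)%R with (M k * (/ 2) ^ S N * 2)%R
        by (simpl; field).
      exact (is_series_scal (M k * (/ 2) ^ S N)%R _ _ Hgeom). }
  (* The partial sum of the column sums is the sum over the rows of their
     partial sums, so the errors of the rows add up. *)
  assert (Herr : forall N, (Cmod (l - sum_n c N) <= (/ 2) ^ N * m)%R).
  { intros N.
    refine (Cmod_Cseries_le (fun k => r k - sum_n (a k) N)
              (fun k => (/ 2) ^ N * M k)%R _ _ _ _ _).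
    - intros k. apply Htail.
    - apply is_Cseries_minus; [exact Hl | now apply is_Cseries_sum_n].
    - exact (is_series_scal ((/ 2) ^ N)%R _ _ HM). }
  assert (Hlim : is_lim_seq (fun N => (/ 2) ^ N * m)%R 0).
  { replace (Finite 0) with (Rbar_mult (Finite 0) (Finite m))
      by (simpl; f_equal; ring).
    apply is_lim_seq_mult'; [|apply is_lim_seq_const].
    apply is_lim_seq_geom. rewrite Rabs_pos_eq; lra. }
  apply is_Cseries_iff; split.
  - refine (is_lim_seq_squeeze _ (fun N => (/ 2) ^ N * m)%R (Re l) _ Hlim).
    intros N. rewrite <- Re_sum_n.
    exact (Rle_trans _ _ _ (re_le_Cmod _) (Herr N)).
  - refine (is_lim_seq_squeeze _ (fun N => (/ 2) ^ N * m)%R (Im l) _ Hlim).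
    intros N. rewrite <- Im_sum_n.
    exact (Rle_trans _ _ _ (im_le_Cmod _) (Herr N)).
Qed.

(** * The complex exponential *)

Lemma Cexp_plus (z w : C) : Cexp (z + w) = Cexp z * Cexp w.
Proof.
  destruct z as [x y], w as [x' y']. unfold Cexp, Re, Im.
  apply injective_projections; simpl;
    rewrite exp_plus, ?cos_plus, ?sin_plus; ring.
Qed.

Lemma Cexp_0 : Cexp 0 = 1.
Proof.
  unfold Cexp; simpl. rewrite exp_0, cos_0, sin_0.
  apply injective_projections; simpl; ring.
Qed.

Lemma Cexp_nat_mult (z : C) (k : nat) : Cexp (INR k * z) = Cexp z ^ k.
Proof.
  induction k as [|k IH].
  - simpl INR. now rewrite Cmult_0_l, Cexp_0.
  - rewrite S_INR, RtoC_plus, Cpow_S, <- IH, <- Cexp_plus. f_equal. ring.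
Qed.

Lemma Cmod_Cexp (z : C) : Cmod (Cexp z) = exp (Re z).
Proof.
  unfold Cmod, Cexp; simpl.
  replace (_ + _)%R with (exp (Re z) * exp (Re z))%R.
  - apply sqrt_square, Rlt_le, exp_pos.
  - generalize (sin2_cos2 (Im z)). unfold Rsqr.
    generalize (cos (Im z)) (sin (Im z)) (exp (Re z)). intros c s e H.
    transitivity (e * e * (s * s + c * c))%R; [rewrite H|]; ring.
Qed.

Lemma is_derive_n_Re_Cexp (c w : C) (n : nat) (s : R) :
  is_derive_n (fun s : R => Re (c * Cexp (s * w))) n s
    (Re (c * w ^ n * Cexp (s * w))).
Proof.
  revert s. induction n as [|n IH]; intros s.
  - change (Re (c * Cexp (s * w)) = Re (c * 1 * Cexp (s * w))).
    f_equal. ring.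
  - apply (is_derive_ext (fun s : R => Re (c * w ^ n * Cexp (s * w)))).
    { intros t. symmetry. destruct n.
      - change (Re (c * Cexp (t * w)) = Re (c * 1 * Cexp (t * w))).
        f_equal. ring.
      - apply is_derive_n_unique, IH. }
    rewrite Cpow_S.
    generalize (w ^ n). intros v. destruct c as [c1 c2], w as [w1 w2], v as [v1 v2].
    unfold Cexp. simpl. auto_derive; [trivial|].
    unfold Rminus. ring.
Qed.

(** Taylor expansion of [s |-> Re (c * Cexp (s * w))] at 0.  With [w] on the
    unit circle, all derivatives are bounded on a bounded interval by one
    constant, so the remainder tends to 0. *)
Lemma is_series_Re_Cexp (c w : C) (s : R) :
  Cmod w = 1%R ->
  is_series (fun n => Re (c * ((s * w) ^ n / INR (fact n))))
    (Re (c * Cexp (s * w))).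
Proof.
  intros Hw.
  (* Any radius greater than [Rabs s] would do. *)
  pose (r := (Rabs s + 1)%R).
  pose proof (mk_pseries (fun s : R => Re (c * Cexp (s * w)))
                (Cmod c * exp r) r) as H.
  refine (is_series_ext _ _ _ _ (H _ s _)).
  - intros n. rewrite (is_derive_n_unique _ _ _ _ (is_derive_n_Re_Cexp c w n 0)).
    rewrite Cmult_0_l, Cexp_0, Cmult_1_r.
    rewrite Cpow_mult_l, <- RtoC_pow, pow_n_pow.
    unfold Cdiv. rewrite <- RtoC_inv by apply INR_fact_neq_0.
    generalize (w ^ n). intros v. unfold scal; simpl. unfold mult; simpl.
    destruct c, v. simpl. unfold Rdiv. ring.
  - intros n x Hx. split.
    + destruct n; [exact I|].
      eexists. exact (is_derive_n_Re_Cexp c w (S n) x).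
    + rewrite (is_derive_n_unique _ _ _ _ (is_derive_n_Re_Cexp c w n x)).
      eapply Rle_trans; [apply re_le_Cmod|].
      rewrite !Cmod_mult, Cmod_pow, Hw, pow1, Rmult_1_r, Cmod_Cexp.
      apply Rmult_le_compat_l; [apply Cmod_ge_0|].
      apply Rlt_le, exp_increasing.
      eapply Rle_lt_trans; [apply Rle_abs|].
      eapply Rle_lt_trans; [apply re_le_Cmod|].
      rewrite Cmod_mult, Hw, Cmod_R, Rmult_1_r. exact Hx.
  - simpl. unfold r. lra.
Qed.

Lemma is_Cseries_Cexp (z : C) :
  is_Cseries (fun n => z ^ n / INR (fact n)) (Cexp z).
Proof.
  assert (H : exists (s : R) (w : C), Cmod w = 1%R /\ z = s * w).
  { destruct (Ceq_dec z 0) as [->|Hz].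
    - exists 0%R, 1. split; [apply Cmod_1 | ring].
    - assert (Hm : Cmod z <> 0%R).
      { intros E. now apply Hz, Cmod_eq_0. }
      assert (Hm' : RtoC (Cmod z) <> 0).
      { intros E. now apply Hm, RtoC_inj. }
      exists (Cmod z), (z / Cmod z). split.
      + rewrite Cmod_div, Cmod_R by exact Hm'.
        rewrite (Rabs_pos_eq (Cmod z)) by apply Cmod_ge_0. now field.
      + now field. }
  destruct H as (s & w & Hw & ->).
  apply is_Cseries_iff; split.
  - generalize (is_series_Re_Cexp 1 w s Hw). rewrite Cmult_1_l.
    apply is_series_ext. intros n. now rewrite Cmult_1_l.
  (* The imaginary part is the real part after multiplication by [- Ci]. *)
  - assert (Hi : forall u, Re (- Ci * u) = Im u).
    { intros [u1 u2]. simpl. ring. }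
    generalize (is_series_Re_Cexp (- Ci) w s Hw). rewrite Hi.
    apply is_series_ext. intros n. apply Hi.
Qed.

(** * Exponential generating functions *)

Lemma fact_neq_0_C (m : nat) : RtoC (INR (fact m)) <> 0.
Proof. intros E. apply RtoC_inj in E. now apply INR_fact_neq_0 in E. Qed.

(** Coefficients of a product of exponential generating functions. *)
Definition binomial_convolution (a b : nat -> C) (n : nat) : C :=
  sum_n (fun k => RtoC (Binomial.C n k) * a k * b (n - k)%nat) n.

(** Every point of [D] can be pushed slightly away from 0 along its ray without
    leaving [D]: this gives absolute convergence of power series on [D]. *)
Definition star_open (D : C -> Prop) : Prop :=
  forall t, D t -> exists s : R, (1 < s)%R /\ D (s * t).

(** [D] is a neighbourhood of 0. *)
Definition is_nbhd_0 (D : C -> Prop) : Prop :=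
  exists r : R, (0 < r)%R /\ forall t, (Cmod t < r)%R -> D t.

(** Convergence at [s * t] with [1 < s] bounds the terms there, so the terms at
    [t] are dominated by a geometric series of ratio [/ s]. *)
Lemma is_egf_abs (D : C -> Prop) (f : C -> C) (a : nat -> C) (t : C) :
  star_open D -> is_egf D f a -> D t -> t <> 0 ->
  ex_series (fun n => Cmod (a n * (t ^ n / INR (fact n)))).
Proof.
  intros HD Ha Ht Ht0.
  destruct (HD t Ht) as (s & Hs & Hst).
  assert (Hs0 : RtoC s <> 0) by (intros E; apply RtoC_inj in E; lra).
  assert (Hst0 : s * t <> 0) by now apply Cmult_neq_0.
  pose proof (Ha _ Hst Hst0) as Hser.
  assert (Hb : exists M, forall n,
            (Cmod (a n * ((s * t) ^ n / INR (fact n))) <= M)%R).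
  { apply is_Cseries_iff in Hser. destruct Hser as [H1 H2].
    assert (Hbd : forall u : nat -> R, ex_series u ->
              exists M, forall n, (Rabs (u n) <= M)%R).
    { intros u Hu. apply ex_series_lim_0 in Hu.
      apply is_lim_seq_Reals in Hu.
      destruct (maj_by_pos u) as (M & _ & HM); [now exists 0%R|].
      now exists M. }
    destruct (Hbd _ (ex_intro _ _ H1)) as [M1 HM1].
    destruct (Hbd _ (ex_intro _ _ H2)) as [M2 HM2].
    exists (sqrt 2 * Rmax M1 M2)%R. intros n.
    eapply Rle_trans; [apply Cmod_2Rmax|].
    apply Rmult_le_compat_l; [apply sqrt_pos|].
    apply Rmax_case.
    - eapply Rle_trans; [apply HM1 | apply Rmax_l].
    - eapply Rle_trans; [apply HM2 | apply Rmax_r]. }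
  destruct Hb as [M HM].
  apply (ex_series_le (K := R_AbsRing) (V := R_CompleteNormedModule))
    with (fun n => M * (/ s) ^ n)%R.
  - intros n. unfold norm; simpl. unfold abs; simpl.
    rewrite Rabs_pos_eq by apply Cmod_ge_0.
    assert (Hsn : (0 < s ^ n)%R) by (apply pow_lt; lra).
    apply (Rmult_le_reg_r (s ^ n)); [exact Hsn|].
    rewrite Rmult_assoc, <- Rpow_mult_distr, Rinv_l, pow1, Rmult_1_r by lra.
    eapply Rle_trans; [|apply (HM n)]. apply Req_le.
    rewrite <- (Rabs_pos_eq (s ^ n)) by lra.
    rewrite <- Cmod_R, <- Cmod_mult. f_equal.
    rewrite Cpow_mult_l, RtoC_pow. unfold Cdiv. ring.
  - apply (ex_series_scal (K := R_AbsRing) (V := R_NormedModule) M).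
    apply ex_series_geom. rewrite Rabs_pos_eq.
    + rewrite <- Rinv_1. apply Rinv_lt_contravar; lra.
    + apply Rlt_le, Rinv_0_lt_compat. lra.
Qed.

Lemma is_egf_mult (D : C -> Prop) (f g : C -> C) (a b : nat -> C) :
  star_open D -> is_egf D f a -> is_egf D g b ->
  is_egf D (fun t => f t * g t) (binomial_convolution a b).
Proof.
  intros HD Ha Hb t Ht Ht0.
  refine (is_Cseries_ext _ _ _ _
            (is_Cseries_mult _ _ _ _ (Ha t Ht Ht0) (Hb t Ht Ht0)
               (is_egf_abs D f a t HD Ha Ht Ht0)
               (is_egf_abs D g b t HD Hb Ht Ht0))).
  intros n. unfold binomial_convolution.
  refine (eq_trans _ (sum_n_mult_r (K := C_Ring) (t ^ n / INR (fact n)) _ n)).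
  apply sum_n_ext_loc. intros k Hk.
  change (a k * (t ^ k / INR (fact k))
          * (b (n - k)%nat * (t ^ (n - k) / INR (fact (n - k))))
          = RtoC (Binomial.C n k) * a k * b (n - k)%nat
            * (t ^ n / INR (fact n))).
  replace (t ^ n) with (t ^ k * t ^ (n - k))
    by (rewrite <- Cpow_add_r; f_equal; lia).
  unfold Binomial.C.
  rewrite RtoC_div, RtoC_mult.
  - field. repeat split; apply fact_neq_0_C.
  - apply Rmult_integral_contrapositive_currified; apply INR_fact_neq_0.
Qed.

(** A real power series vanishing on a punctured neighbourhood of 0 has zero
    coefficients. *)
Lemma pseries_zero_coef (p : nat -> R) (r : R) :
  (0 < r)%R ->
  (forall t : R, t <> 0%R -> (Rabs t < r)%R -> is_pseries p t 0%R) ->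
  forall n, p n = 0%R.
Proof.
  intros Hr H n.
  assert (Hcv : Rbar_lt 0 (CV_radius p)).
  { destruct (Rbar_lt_le_dec 0 (CV_radius p)) as [Hlt|Hle]; [exact Hlt|].
    exfalso. apply (CV_disk_outside p (r / 2)).
    - eapply Rbar_le_lt_trans; [exact Hle|]. simpl. apply Rabs_pos_lt. lra.
    - apply (is_lim_seq_ext (fun n => scal (pow_n (r / 2)%R n) (p n))).
      { intros m. rewrite pow_n_pow. apply Rmult_comm. }
      apply ex_series_lim_0. exists 0%R. apply H; [lra|].
      rewrite Rabs_pos_eq; lra. }
  (* Nothing is assumed at [t = 0]; multiplying the series by [t] makes it
     vanish there too, and only shifts the coefficients. *)
  change (PS_incr_1 p (S n) = 0%R).
  apply (PSeries_ext_recip (PS_incr_1 p) (fun _ => 0%R) (S n)).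
  - now rewrite CV_radius_incr_1.
  - now rewrite CV_radius_const_0.
  - exists (mkposreal r Hr). intros t Ht.
    rewrite PSeries_const_0, PSeries_incr_1.
    destruct (Req_dec t 0) as [->|Ht0]; [apply Rmult_0_l|].
    rewrite (is_pseries_unique p t 0); [apply Rmult_0_r|].
    apply H; [exact Ht0|].
    revert Ht. unfold ball; simpl. unfold AbsRing_ball, abs, minus, plus, opp.
    simpl. now rewrite Ropp_0, Rplus_0_r.
Qed.

(** Real values of [t] suffice: there the real and imaginary parts of the
    difference are real power series with sum 0. *)
Lemma is_egf_unique (D : C -> Prop) (f : C -> C) (a b : nat -> C) :
  is_nbhd_0 D -> is_egf D f a -> is_egf D f b -> forall n, a n = b n.
Proof.
  intros (r & Hr & HD) Ha Hb n.
  assert (H : forall t : R, t <> 0%R -> (Rabs t < r)%R ->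
            is_Cseries (fun n => (a n - b n) * (t ^ n / INR (fact n))%R) 0).
  { intros t Ht0 Htr.
    assert (Ht : D t) by (apply HD; now rewrite Cmod_R).
    assert (Ht0' : RtoC t <> 0) by (intros E; now apply Ht0, RtoC_inj).
    replace (RtoC 0) with (f t - f t) by ring.
    refine (is_Cseries_ext _ _ _ _
              (is_Cseries_minus _ _ _ _ (Ha t Ht Ht0') (Hb t Ht Ht0'))).
    intros m. rewrite RtoC_div, RtoC_pow by apply INR_fact_neq_0. ring. }
  assert (Hz : forall u : nat -> R,
            (forall t : R, t <> 0%R -> (Rabs t < r)%R ->
               is_series (fun n => u n * (t ^ n / INR (fact n)))%R 0%R) ->
            forall n, u n = 0%R).
  { intros u Hu m.
    assert (E : (u m / INR (fact m))%R = 0%R).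
    { apply (pseries_zero_coef (fun m => u m / INR (fact m))%R r Hr).
      intros t Ht0 Htr.
      refine (is_series_ext _ _ _ _ (Hu t Ht0 Htr)).
      intros k. transitivity (t ^ k * (u k / INR (fact k)))%R.
      - change (u k * (t ^ k / INR (fact k)) = t ^ k * (u k / INR (fact k)))%R.
        unfold Rdiv. ring.
      - now rewrite <- pow_n_pow. }
    pose proof (INR_fact_neq_0 m).
    replace (u m) with (u m / INR (fact m) * INR (fact m))%R by now field.
    rewrite E. ring. }
  apply injective_projections; apply Rminus_diag_uniq.
  - apply (Hz (fun n => fst (a n) - fst (b n))%R). intros t Ht0 Htr.
    destruct (proj1 (is_Cseries_iff _ _) (H t Ht0 Htr)) as [H1 _].
    revert H1. apply is_series_ext. intros m. simpl. unfold Re. ring.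
  - apply (Hz (fun n => snd (a n) - snd (b n))%R). intros t Ht0 Htr.
    destruct (proj1 (is_Cseries_iff _ _) (H t Ht0 Htr)) as [_ H1].
    revert H1. apply is_series_ext. intros m. simpl. unfold Im. ring.
Qed.

Lemma egf_coef_eq (D : C -> Prop) (f : C -> C) (a : nat -> C) (n : nat) :
  is_nbhd_0 D -> is_egf D f a -> egf_coef D f n = a n.
Proof.
  intros HD Ha. unfold egf_coef.
  destruct (excluded_middle_informative _) as [h|h].
  - destruct (constructive_indefinite_description _ h) as [b Hb]. simpl.
    exact (is_egf_unique D f b a HD Hb Ha n).
  - destruct h. now exists a.
Qed.

Lemma egf_coef_none (D : C -> Prop) (f : C -> C) (n : nat) :
  (forall a, ~ is_egf D f a) -> egf_coef D f n = 0.
Proof.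
  intros H. unfold egf_coef.
  destruct (excluded_middle_informative _) as [[a Ha]|h]; [|reflexivity].
  now destruct (H a).
Qed.

Lemma is_egf_ext (D D' : C -> Prop) (f g : C -> C) (a : nat -> C) :
  (forall t, D' t -> D t) -> (forall t, f t = g t) ->
  is_egf D f a -> is_egf D' g a.
Proof. intros HD Hfg Ha t Ht Ht0. rewrite <- Hfg. apply Ha; auto. Qed.

(** * Dobinski's formula for the Bell polynomials *)

(** The bivariate Bell polynomial as
    [e^(-x2) sum_k x2^k/k! (x1 + k)^n]. *)
Definition dobinski (x1 x2 : C) (n : nat) : C :=
  Cexp (- x2) * CSeries (fun k => x2 ^ k / INR (fact k) * (x1 + INR k) ^ n).

Lemma pow_fact_le_exp (y : R) (n : nat) :
  (0 <= y)%R -> (y ^ n / INR (fact n) <= exp y)%R.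
Proof.
  intros Hy. eapply Rle_trans; [|apply (exp_ge_taylor y n Hy)].
  destruct n as [|n]; [apply Rle_refl|].
  rewrite tech5. rewrite <- (Rplus_0_l (_ / _)) at 1.
  apply Rplus_le_compat_r, cond_pos_sum. intros k.
  apply Rmult_le_pos; [now apply pow_le|].
  apply Rlt_le, Rinv_0_lt_compat, INR_fact_lt_0.
Qed.

(** The factor of the bound that depends on the row [k] of the double series:
    [y^n/n! <= e^(2y) (/ 2)^n] for [y = (|x1| + k) |t|]. *)
Definition dobinski_bound (x1 x2 t : C) (k : nat) : R :=
  (Cmod x2 ^ k / INR (fact k) * exp (2 * ((Cmod x1 + INR k) * Cmod t)))%R.

Lemma dobinski_term_le (x1 x2 t : C) (k n : nat) :
  (Cmod (x2 ^ k / INR (fact k) * (((x1 + INR k) * t) ^ n / INR (fact n)))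
   <= dobinski_bound x1 x2 t k * (/ 2) ^ n)%R.
Proof.
  assert (Hp : forall m, (0 < INR (fact m))%R) by apply INR_fact_lt_0.
  unfold dobinski_bound.
  rewrite Cmod_mult, !Cmod_div, !Cmod_pow, !Cmod_R, Cmod_mult by apply fact_neq_0_C.
  rewrite !(Rabs_pos_eq (INR _)) by apply pos_INR.
  rewrite Rmult_assoc. apply Rmult_le_compat_l.
  { apply Rmult_le_pos; [apply pow_le, Cmod_ge_0|].
    apply Rlt_le, Rinv_0_lt_compat, Hp. }
  pose (y := ((Cmod x1 + INR k) * Cmod t)%R).
  assert (Hy : (0 <= y)%R).
  { apply Rmult_le_pos; [|apply Cmod_ge_0].
    apply Rplus_le_le_0_compat; [apply Cmod_ge_0 | apply pos_INR]. }
  apply Rle_trans with (y ^ n / INR (fact n))%R.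
  - apply Rmult_le_compat_r; [apply Rlt_le, Rinv_0_lt_compat, Hp|].
    apply pow_incr. split.
    { apply Rmult_le_pos; apply Cmod_ge_0. }
    apply Rmult_le_compat_r; [apply Cmod_ge_0|].
    eapply Rle_trans; [apply Cmod_triangle|].
    rewrite Cmod_R, Rabs_pos_eq by apply pos_INR. apply Rle_refl.
  - fold y.
    replace (y ^ n / INR (fact n))%R
      with ((2 * y) ^ n / INR (fact n) * (/ 2) ^ n)%R.
    + apply Rmult_le_compat_r; [apply pow_le; lra|].
      apply pow_fact_le_exp. lra.
    + unfold Rdiv.
      rewrite Rmult_assoc, (Rmult_comm (/ _)), <- Rmult_assoc.
      rewrite <- Rpow_mult_distr. do 2 f_equal. field.
Qed.

Lemma ex_series_dobinski_bound (x1 x2 t : C) :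
  ex_series (dobinski_bound x1 x2 t).
Proof.
  exists (exp (2 * (Cmod x1 * Cmod t))
          * exp (Cmod x2 * exp (2 * Cmod t)))%R.
  refine (is_series_ext _ _ _ _
            (is_series_scal (exp (2 * (Cmod x1 * Cmod t))) _ _
               (is_exp_Reals (Cmod x2 * exp (2 * Cmod t))))).
  intros k. rewrite pow_n_pow. unfold scal; simpl. unfold mult; simpl.
  unfold dobinski_bound.
  replace (2 * ((Cmod x1 + INR k) * Cmod t))%R
    with (2 * (Cmod x1 * Cmod t) + INR k * (2 * Cmod t))%R by ring.
  rewrite exp_plus, Rpow_mult_distr.
  replace (exp (INR k * (2 * Cmod t))) with (exp (2 * Cmod t) ^ k)%R.
  - unfold Rdiv. ring.
  - induction k as [|k IH].
    + simpl. now rewrite Rmult_0_l, exp_0.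
    + rewrite S_INR, Rmult_plus_distr_r, exp_plus, <- IH, Rmult_1_l.
      simpl. ring.
Qed.

Lemma is_egf_dobinski (x1 x2 : C) :
  is_egf (fun _ => True) (fun t => Cexp (x1 * t) * Cexp (x2 * (Cexp t - 1)))
    (dobinski x1 x2).
Proof.
  intros t _ _.
  assert (Hcol : forall n,
    is_Cseries (fun k => x2 ^ k / INR (fact k) * (x1 + INR k) ^ n)
      (CSeries (fun k => x2 ^ k / INR (fact k) * (x1 + INR k) ^ n))).
  (* The bound at [t = 1], multiplied by [n!], dominates the [n]-th column. *)
  { intros n.
    apply is_Cseries_dominated
      with (fun k => INR (fact n) * (/ 2) ^ n * dobinski_bound x1 x2 1 k)%R.
    - intros k. generalize (dobinski_term_le x1 x2 1 k n). intros H.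
      apply (Rmult_le_compat_l (INR (fact n))) in H; [|apply pos_INR].
      eapply Rle_trans; [|eapply Rle_trans; [exact H|]].
      + apply Req_le.
        rewrite <- (Rabs_pos_eq (INR (fact n))) at 1 by apply pos_INR.
        rewrite <- Cmod_R, <- Cmod_mult. f_equal.
        rewrite Cmult_1_r. field. split; apply fact_neq_0_C.
      + apply Req_le. ring.
    - apply (ex_series_scal (K := R_AbsRing) (V := R_NormedModule)).
      apply ex_series_dobinski_bound. }
  replace (Cexp (x1 * t) * Cexp (x2 * (Cexp t - 1)))
    with (Cexp (- x2) * (Cexp (x1 * t) * Cexp (x2 * Cexp t))).
  2:{ rewrite <- !Cexp_plus. f_equal. ring. }
  apply is_Cseries_ext with
    (fun n => Cexp (- x2) *
       (t ^ n / INR (fact n)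
        * CSeries (fun k => x2 ^ k / INR (fact k) * (x1 + INR k) ^ n))).
  { intros n. unfold dobinski. ring. }
  apply is_Cseries_scal.
  apply is_Cseries_swap with
    (a := fun k n => x2 ^ k / INR (fact k)
                     * (((x1 + INR k) * t) ^ n / INR (fact n)))
    (M := dobinski_bound x1 x2 t)
    (r := fun k => x2 ^ k / INR (fact k) * Cexp ((x1 + INR k) * t)).
  - apply dobinski_term_le.
  - apply ex_series_dobinski_bound.
  - intros k. apply is_Cseries_scal, is_Cseries_Cexp.
  - intros n.
    refine (is_Cseries_ext _ _ _ _ (is_Cseries_scal _ _ _ (Hcol n))).
    intros k. simpl. rewrite Cpow_mult_l. unfold Cdiv. ring.
  - refine (is_Cseries_ext _ _ _ _
              (is_Cseries_scal (Cexp (x1 * t)) _ _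
                 (is_Cseries_Cexp (x2 * Cexp t)))).
    intros k. simpl.
    rewrite Cmult_plus_distr_r, Cexp_plus, Cexp_nat_mult, Cpow_mult_l.
    unfold Cdiv. ring.
Qed.

(** * The disc of convergence *)

Lemma Clog_eq_0 (z : C) : z <> 0 -> Clog z = 0 -> z = 1.
Proof.
  intros Hz H. unfold Clog in H. injection H. intros Harg Hln.
  assert (Hm : Cmod z = 1%R).
  { assert (0 < Cmod z)%R by now apply Cmod_gt_0.
    rewrite <- (exp_ln (Cmod z)), Hln by assumption. apply exp_0. }
  assert (Hre : Re z = 1%R).
  { assert (Hb : (-1 <= Re z <= 1)%R).
    { apply Rabs_le_between. rewrite <- Hm. apply re_le_Cmod. }
    rewrite <- (cos_acos (Re z) Hb), <- cos_0. f_equal.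
    revert Harg. unfold Carg. rewrite Hm, Rdiv_1_r.
    destruct (Rle_dec 0 (Im z)); lra. }
  assert (Him : Im z = 0%R).
  { assert (E : (Cmod z * Cmod z = Re z * Re z + Im z * Im z)%R).
    { unfold Cmod. rewrite sqrt_sqrt; [unfold Re, Im; ring|].
      apply Rplus_le_le_0_compat; apply pow2_ge_0. }
    rewrite Hm, Hre in E. apply Rsqr_0_uniq. unfold Rsqr. lra. }
  now apply injective_projections.
Qed.

(** The disc is the whole plane or an open disc of positive radius: the
    principal logarithm of [- lambda] vanishes only for [lambda = -1], where the
    radius is [2 * PI]. *)
Lemma apostol_disc_cases (lambda : C) :
  (forall t, apostol_disc lambda t) \/
  exists r : R, (0 < r)%R /\
    forall t, apostol_disc lambda t <-> (Cmod t < r)%R.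
Proof.
  unfold apostol_disc.
  destruct (Ceq_dec lambda 0) as [|H0]; [now left|right].
  destruct (Ceq_dec lambda (-1)) as [|H1].
  - exists (2 * PI)%R. split; [|reflexivity]. generalize PI_RGT_0. lra.
  - exists (Cmod (Clog (- lambda))). split; [|reflexivity].
    apply Cmod_gt_0. intros H. apply Clog_eq_0 in H.
    + apply H1. replace lambda with (- - lambda) by ring.
      rewrite H. now rewrite <- RtoC_opp.
    + intros E. apply H0. replace lambda with (- - lambda) by ring.
      rewrite E. ring.
Qed.

Lemma apostol_disc_nbhd (lambda : C) : is_nbhd_0 (apostol_disc lambda).
Proof.
  destruct (apostol_disc_cases lambda) as [H|(r & Hr & H)].
  - exists 1%R. split; [lra | auto].
  - exists r. split; [exact Hr | apply H].
Qed.

Lemma apostol_disc_star_open (lambda : C) : star_open (apostol_disc lambda).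
Proof.
  destruct (apostol_disc_cases lambda) as [H|(r & Hr & H)]; intros t Ht.
  - exists 2%R. split; [lra | apply H].
  - apply H in Ht.
    destruct (Req_dec (Cmod t) 0) as [E|E].
    + exists 2%R. split; [lra|]. apply H. now rewrite Cmod_mult, E, Rmult_0_r.
    + assert (Hp : (0 < Cmod t)%R) by (generalize (Cmod_ge_0 t); lra).
      assert (Hs : (1 < (1 + r / Cmod t) / 2)%R).
      { assert (1 < r / Cmod t)%R; [|lra].
        apply (Rmult_lt_reg_r (Cmod t)); [exact Hp|].
        unfold Rdiv. rewrite Rmult_assoc, Rinv_l by exact E. lra. }
      (* This factor takes [Cmod t] to the midpoint of [Cmod t] and [r]. *)
      exists ((1 + r / Cmod t) / 2)%R. split; [exact Hs|].
      apply H. rewrite Cmod_mult, Cmod_R, Rabs_pos_eq by lra.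
      replace ((1 + r / Cmod t) / 2 * Cmod t)%R with ((Cmod t + r) / 2)%R
        by now field.
      lra.
Qed.

Theorem theorem2p2 (alpha : nat) (lambda eta delta x1 x2 : C) (n : nat)
    (hn : (1 <= n)%nat) :
  bell_apostol alpha x1 x2 lambda eta delta n =
  sum_n (fun k : nat =>
           RtoC (Binomial.C n k)
           * apostol alpha 0 lambda eta delta k
           * bell x1 x2 (n - k)) n.
Proof.
  set (D := apostol_disc lambda).
  set (F := apostol_factor alpha lambda eta delta).
  assert (HD0 : is_nbhd_0 D) by apply apostol_disc_nbhd.
  assert (HDs : star_open D) by apply apostol_disc_star_open.
  assert (Hbell : forall m, bell x1 x2 m = dobinski x1 x2 m).
  { intros m. apply egf_coef_eq; [|apply is_egf_dobinski].
    exists 1%R. split; [lra | auto]. }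
  assert (Hexp : forall y1 y2 : C,
            is_egf D (fun t => Cexp (y1 * t + y2 * (Cexp t - 1)))
              (dobinski y1 y2)).
  { intros y1 y2. refine (is_egf_ext _ _ _ _ _ _ _ (is_egf_dobinski y1 y2)).
    - auto.
    - intros t. now rewrite Cexp_plus. }
  destruct (excluded_middle_informative
              (exists a, is_egf D (fun t => F t * Cexp (0 * t)) a))
    as [[a Ha]|Hnone].
  - assert (Hap : forall k, apostol alpha 0 lambda eta delta k = a k).
    { intros k. now apply egf_coef_eq. }
    transitivity (binomial_convolution a (dobinski x1 x2) n).
    + apply egf_coef_eq; [exact HD0|].
      refine (is_egf_ext D D _ _ _ _ _
                (is_egf_mult _ _ _ _ _ HDs Ha (Hexp x1 x2))); [auto|].
      intros t. simpl. now rewrite Cmult_0_l, Cexp_0, Cmult_1_r.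
    + apply sum_n_ext. intros k. now rewrite Hap, Hbell.
  - assert (Hap : forall k, apostol alpha 0 lambda eta delta k = 0).
    { intros k. apply egf_coef_none. intros a Ha. now apply Hnone; exists a. }
    transitivity (RtoC 0).
    + apply egf_coef_none. intros b Hb. apply Hnone.
      exists (binomial_convolution b (dobinski (- x1) (- x2))).
      refine (is_egf_ext D D _ _ _ _ _
                (is_egf_mult _ _ _ _ _ HDs Hb (Hexp (- x1) (- x2)))); [auto|].
      intros t. simpl. rewrite <- Cmult_assoc, <- Cexp_plus.
      unfold F. do 2 f_equal. ring.
    + symmetry.
      rewrite (sum_n_ext _ (fun _ => RtoC 0)).
      * clear. induction n as [|n IH]; [now rewrite sum_O|].
        rewrite sum_Sn, IH. apply Cplus_0_l.
      * intros k. rewrite Hap. now rewrite Cmult_0_r, Cmult_0_l.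
Qed.
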